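(* There is a polynomial-time algorithm which, given an integer $k\ge 1$, a connected graph $G$ with $n$ vertices and $m$ edges and an edge-coloring $c:E(G)\to\{1,2,\dots,k\}$, determines for each pair of distinct vertices $u,v$ of $G$ whether there is a conflict-free path between $u$ and $v$ of length $d_G(u,v)$; its running time is at most $\mathcal{O}(n^2m^2)$.
   Context: All graphs are simple, undirected and finite. Edge-colorings are arbitrary (adjacent edges may receive the same color). In an edge-colored graph, a path is conflict-free if some color is used on exactly one of its edges. $d_G(u,v)$ is the distance between $u$ and $v$ in $G$, and the length of a path is its number of edges. *)

(* Defs.v *)
From mathcomp Require Import all_boot.

Set Implicit Arguments.
Unset Strict Implicit.
Unset Printing Implicit Defensive.

(** * Graphs

    A simple graph is a symmetric irreflexive relation on a finite type. As is
    usual with [path], the sequence of vertices [u, x1, ..., xl] is split into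
    its head [u] and its tail [p = [:: x1; ...; xl]], so that its length, in
    number of edges, is [size p]. *)

Section Graph.
Variables (V : finType) (e : rel V).

Definition edges : {set {set V}} :=
  [set [set q.1; q.2] | q : V * V & e q.1 q.2].

Definition gpath (u v : V) (p : seq V) : bool :=
  [&& path e u p, last u p == v & uniq (u :: p)].

(** The least length of a path between [u] and [v]. A path has less than
    [#|V|] edges; the value is [#|V|] if there is no path. *)
Definition gdist (u v : V) : nat :=
  find (fun d => [exists p : d.-tuple V, gpath u v p]) (iota 0 #|V|).

Definition path_edges (u : V) (p : seq V) : seq {set V} :=
  pairmap (fun x y => [set x; y]) u p.

Definition conflict_free (c : {set V} -> nat) (u : V) (p : seq V) : Prop :=
  exists a : nat, count (fun f => c f == a) (path_edges u p) = 1.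

Definition conflict_free_geodesic (c : {set V} -> nat) (u v : V) : Prop :=
  exists p : seq V,
    [/\ gpath u v p, size p = gdist u v & conflict_free c u p].

(** [s] lists every edge exactly once, in any order and with either
    orientation. *)
Definition edge_list (s : seq (V * V)) : bool :=
  perm_eq [seq [set q.1; q.2] | q <- s] (enum edges).

End Graph.

(** * Word RAM

    Structured programs over registers [Reg x] and random access arrays
    [Get a i], where [x] and the array name [a] are literals of the program,
    while [i] is computed. Every constant, register access, array access,
    addition, (truncated) subtraction, comparison and assignment costs one time
    unit. Execution is stuck as soon as the value of an expression exceeds the
    word bound [B], so that large numbers cannot be used to do more than a
    constant amount of work in one unit of time. *)

Inductive expr : Type :=
| Const of nat
| Reg of nat
| Get of nat & expr
| Add of expr & expr
| Sub of expr & expr.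

Inductive test : Type :=
| Lt of expr & expr
| Eq of expr & expr.

Inductive cmd : Type :=
| Skip
| Assign of nat & expr
| Put of nat & expr & expr (* [Put a i v] is [a[i] := v] *)
| Seq of cmd & cmd
| If of test & cmd & cmd
| While of test & cmd.

Record state : Type := State { reg : nat -> nat; arr : nat -> nat -> nat }.

Definition set_reg (s : state) (x v : nat) : state :=
  State (fun y => if y == x then v else reg s y) (arr s).

Definition set_arr (s : state) (a i v : nat) : state :=
  State (reg s)
    (fun b j => if (b == a) && (j == i) then v else arr s b j).

Fixpoint eval (s : state) (x : expr) : nat :=
  match x with
  | Const v => v
  | Reg r => reg s r
  | Get a i => arr s a (eval s i)
  | Add x1 x2 => eval s x1 + eval s x2
  | Sub x1 x2 => eval s x1 - eval s x2
  end.

(** All the values computed in the evaluation of [x] are at most [B]. *)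
Fixpoint fits (B : nat) (s : state) (x : expr) : bool :=
  (eval s x <= B) &&
  match x with
  | Const _ | Reg _ => true
  | Get _ i => fits B s i
  | Add x1 x2 | Sub x1 x2 => fits B s x1 && fits B s x2
  end.

Fixpoint cost (x : expr) : nat :=
  match x with
  | Const _ | Reg _ => 1
  | Get _ i => (cost i).+1
  | Add x1 x2 | Sub x1 x2 => (cost x1 + cost x2).+1
  end.

Definition eval_test (s : state) (b : test) : bool :=
  match b with
  | Lt x1 x2 => eval s x1 < eval s x2
  | Eq x1 x2 => eval s x1 == eval s x2
  end.

Definition fits_test (B : nat) (s : state) (b : test) : bool :=
  match b with Lt x1 x2 | Eq x1 x2 => fits B s x1 && fits B s x2 end.

Definition cost_test (b : test) : nat :=
  match b with Lt x1 x2 | Eq x1 x2 => (cost x1 + cost x2).+1 end.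

(** [exec B p s t s']: with word bound [B] and started in state [s], the program
    [p] halts in state [s'] after exactly [t] time units. *)
Inductive exec (B : nat) : cmd -> state -> nat -> state -> Prop :=
| ExecSkip s : exec B Skip s 0 s
| ExecAssign x v s :
    fits B s v ->
    exec B (Assign x v) s (cost v).+1 (set_reg s x (eval s v))
| ExecPut a i v s :
    fits B s i -> fits B s v ->
    exec B (Put a i v) s (cost i + cost v).+1
      (set_arr s a (eval s i) (eval s v))
| ExecSeq p1 p2 s1 t1 s2 t2 s3 :
    exec B p1 s1 t1 s2 -> exec B p2 s2 t2 s3 ->
    exec B (Seq p1 p2) s1 (t1 + t2) s3
| ExecIf b p1 p2 s t s' :
    fits_test B s b ->
    exec B (if eval_test s b then p1 else p2) s t s' ->
    exec B (If b p1 p2) s (cost_test b + t) s'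
| ExecWhileFalse b p s :
    fits_test B s b -> ~~ eval_test s b ->
    exec B (While b p) s (cost_test b) s
| ExecWhileTrue b p s1 t1 s2 t2 s3 :
    fits_test B s1 b -> eval_test s1 b ->
    exec B p s1 t1 s2 -> exec B (While b p) s2 t2 s3 ->
    exec B (While b p) s1 (cost_test b + t1 + t2) s3.

(** * Input and output

    Registers 0, 1, 2 hold the numbers of vertices, edges and colors; arrays 0,
    1, 2 hold the two ends and the color of each edge. All the rest is 0. *)
Definition input (n k : nat) (c : {set 'I_n} -> nat) (s : seq ('I_n * 'I_n)) :
    state :=
  State
    (nth 0 [:: n; size s; k])
    (nth (fun=> 0)
      [:: nth 0 [seq val q.1 | q <- s];
          nth 0 [seq val q.2 | q <- s];
          nth 0 [seq c [set q.1; q.2] | q <- s]]).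

(** The answer for the pair [(u, v)] is in array 3, at index [u * n + v]:
    1 for yes, 0 for no. *)
Definition answers (n : nat) (s : state) (P : 'I_n -> 'I_n -> Prop) : Prop :=
  forall u v : 'I_n, u != v ->
    (P u v -> arr s 3 (u * n + v) = 1) /\ (~ P u v -> arr s 3 (u * n + v) = 0).

(* Main.v *)
Require Import Defs.
From mathcomp Require Import all_boot.
From mathcomp Require Import zify.

Set Implicit Arguments.
Unset Strict Implicit.
Unset Printing Implicit Defensive.

(** A walk from [u] to [v] with [gdist e u v] edges is automatically a path, so
    the question for [(u, v)] is whether some color [a] occurs exactly once on
    some shortest walk; such an [a] is the color of one of the edges. For a
    fixed source [u] and a fixed color [a], it is settled by dynamic programming
    over the breadth-first layers: a shortest walk with [i] edges of color [a]
    to a vertex of layer [d.+1] is such a walk, with [i] or [i.-1] edges of color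
    [a], to a vertex of layer [d], followed by one edge ([geo_step], [geo_pred]),
    and only [i = 0] and [i = 1] matter. The layers themselves are found along
    the way.

    The program runs this for each source [u] and each edge [j], with
    [a := col j]: in [n] rounds it scans the list of the [m] edges, and relaxes
    each of them in both directions. This makes [n * m * n * m] relaxations of
    constant cost, and the cost of all the rest is dominated by this as soon as
    there is an edge ([time_algorithm_le]).

    Two features of the program make it easy to verify. First, each pair [(u, j)]
    has its own block of cells in the tables (see [addr]), so that nothing is
    ever reset and only nonzero values are ever written: a cell that is nonzero
    remains so until the end ([exec_evolves]), and every completeness
    property (some cell is nonzero) persists without further proof. Second,
    soundness (a nonzero cell tells the truth, [sound]) is a property of all the
    blocks at once, which each write preserves. The main loops then only carry
    [sound] and a completeness property up to the current index: [relaxed] for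
    the edges scanned, [complete] for the layers. *)

(** * Geodesics *)

Section Geodesics.
Variables (V : finType) (e : rel V) (c : {set V} -> nat).
Implicit Types (u v x y : V) (p : seq V).

(** Removing the cycles of a walk gives a path that is no longer. *)
Lemma gdist_le u p : path e u p -> gdist e u (last u p) <= size p.
Proof.
case/shortenP=> q eq uq sub_qp.
apply: leq_trans (uniq_leq_size _ sub_qp); last by case/andP: uq.
rewrite leqNgt; apply/negP=> lt_qd.
have lt_qV : size q < #|V| by have := max_card (mem (u :: q)); rewrite (card_uniqP uq).
have := before_find 0 lt_qd; rewrite nth_iota // add0n => /existsP[].
by exists (in_tuple q); rewrite /gpath /= eq eqxx.
Qed.

Lemma gdist_path u v :
  connect e u v -> exists p, [/\ path e u p, last u p = v & size p = gdist e u v].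
Proof.
case/connectP=> p0 /shortenP[q eq uq _] ->.
have lt_qV : size q < #|V| by have := max_card (mem (u :: q)); rewrite (card_uniqP uq).
have hasq : has (fun d => [exists p : d.-tuple V, gpath e u (last u q) p]) (iota 0 #|V|).
  apply/hasP; exists (size q); first by rewrite mem_iota.
  by apply/existsP; exists (in_tuple q); rewrite /gpath /= eq eqxx.
have := nth_find 0 hasq; rewrite nth_iota; last by rewrite -[X in _ < X](size_iota 0) -has_find.
case/existsP=> p /and3P[ep /eqP lp _]; exists p; split=> //.
by rewrite size_tuple.
Qed.

Lemma gdist_leV u v : gdist e u v <= #|V|.
Proof. by rewrite /gdist -[X in _ <= X](size_iota 0) find_size. Qed.

(** Otherwise, removing the cycles would give a walk shorter than the
    distance. *)
Lemma geodesic_uniq u p : path e u p -> size p = gdist e u (last u p) -> uniq (u :: p).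
Proof.
move=> ep; have := ep; case/shortenP=> q eq uq sub_qp sz_p.
apply: (leq_size_uniq uq) => [x|/=]; last by rewrite ltnS sz_p gdist_le.
by rewrite !inE => /orP[->//|/sub_qp->]; rewrite orbT.
Qed.

(** Distinctness of the vertices is left out: by [geodesic_uniq] it comes for
    free, and without it walks can be extended and cut at will. *)
Definition geo (a i : nat) (u v : V) : Prop :=
  exists p, [/\ path e u p, last u p = v, size p = gdist e u v
              & count (fun f => c f == a) (path_edges u p) = i].

Lemma cfgP u v : conflict_free_geodesic e c u v <-> exists a, geo a 1 u v.
Proof.
split=> [[p [/and3P[ep /eqP lp _] sz [a ca]]]|[a [p [ep lp sz ca]]]].
  by exists a, p.
exists p; split=> //; last by exists a.
by rewrite /gpath ep lp eqxx (geodesic_uniq ep) // lp.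
Qed.

Lemma gdist_refl u : gdist e u u = 0.
Proof. by apply/eqP; rewrite -leqn0; apply: (@gdist_le u [::]). Qed.

Lemma geo_refl a u : geo a 0 u u.
Proof. by exists [::]; split; rewrite ?gdist_refl. Qed.

Lemma gdist_step u x y : connect e u x -> e x y -> gdist e u y <= (gdist e u x).+1.
Proof.
move=> /gdist_path[p [ep lp <-]] exy.
have := @gdist_le u (rcons p y); rewrite size_rcons last_rcons; apply.
by rewrite rcons_path ep lp.
Qed.

Lemma gdist_eq0 u v : connect e u v -> gdist e u v = 0 -> v = u.
Proof. by move=> /gdist_path[[|x p] [_ /= <- <-]]. Qed.

Lemma path_edges_rcons u p y :
  path_edges u (rcons p y) = rcons (path_edges u p) [set last u p; y].
Proof. by rewrite /path_edges -!cats1 pairmap_cat. Qed.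

Lemma geo_step a i (u x y : V) :
  geo a i u x -> e x y -> gdist e u y = (gdist e u x).+1 ->
  geo a (i + (c [set x; y] == a)) u y.
Proof.
move=> [p [ep lp sz ci]] exy dy; exists (rcons p y).
by rewrite rcons_path last_rcons size_rcons path_edges_rcons -cats1 count_cat ep lp exy sz ci /= addn0.
Qed.

(** The converse of [geo_step]: a shortest walk without its last edge is still
    a shortest walk. *)
Lemma geo_pred a i d u y :
  geo a i u y -> gdist e u y = d.+1 ->
  exists x j, [/\ e x y, gdist e u x = d, geo a j u x & i = j + (c [set x; y] == a)].
Proof.
move=> [p [ep lp sz ci]] dy; rewrite dy in sz.
case/lastP: p => [|p z] in ep lp sz ci *; first by [].
rewrite last_rcons in lp; subst z.
rewrite rcons_path in ep; case/andP: ep => ep exy.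
rewrite size_rcons in sz; case: sz => sz.
have cux : connect e u (last u p) by apply/connectP; exists p.
have dx : gdist e u (last u p) = d.
  by apply/eqP; rewrite eqn_leq -{1}sz gdist_le //= -ltnS -dy gdist_step.
exists (last u p), (count (fun f => c f == a) (path_edges u p)); split=> //.
  by exists p; rewrite dx.
by rewrite -ci path_edges_rcons -cats1 count_cat /= addn0.
Qed.

(** This is why it suffices to try the colors of the listed edges. *)
Lemma geo_color a u v : geo a 1 u v -> exists2 f, f \in edges e & c f = a.
Proof.
move=> [p [ep _ _ ca]]; have: has (fun f => c f == a) (path_edges u p) by rewrite has_count ca.
case/hasP=> f fp /eqP <-; exists f => //.
elim: p u ep fp {ca} => //= x p IHp u /andP[eux ep]; rewrite inE => /orP[/eqP->|]; last exact: IHp.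
by apply/imsetP; exists (u, x); rewrite ?inE.
Qed.

End Geodesics.

Lemma gdist_pred (V : finType) (e : rel V) d (u y : V) :
  connect e u y -> gdist e u y = d.+1 -> exists2 x, e x y & gdist e u x = d.
Proof.
move=> /gdist_path[p [ep lp sz]] dy; pose c (f : {set V}) := 0.
(* Colors do not matter, hence the constant coloring [c]. *)
have g : geo e c 0 (count (fun f => c f == 0) (path_edges u p)) u y by exists p.
by have [x [j [exy dx _ _]]] := geo_pred g dy; exists x.
Qed.


Lemma set2_inj (T : finType) (x y z w : T) :
  [set x; y] = [set z; w] -> (x, y) = (z, w) \/ (x, y) = (w, z).
Proof.
move=> E; have := set21 x y; have := set22 x y; rewrite E !inE.
have := set21 z w; have := set22 z w; rewrite -E !inE.
do 4![case/orP=> /eqP ?]; subst; by [left | right].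
Qed.

Lemma card_edges_le (V : finType) (e : rel V) : #|edges e| <= #|V| * #|V|.
Proof. by rewrite -card_prod; apply: leq_trans (leq_imset_card _ _) (max_card _). Qed.

Lemma edges_gt0 (V : finType) (e : rel V) :
  (forall u v, connect e u v) -> 1 < #|V| -> 0 < #|edges e|.
Proof.
move=> e_con /card_gt1P[u [v [_ _ uv]]].
case/connectP: (e_con u v) => [[|x p]] /= => [_ vu|/andP[eux _] _].
  by rewrite vu eqxx in uv.
by apply/card_gt0P; exists [set u; x]; apply/imsetP; exists (u, x); rewrite ?inE.
Qed.

Section EdgeList.
Variables (V : finType) (e : rel V) (s : seq (V * V)).
Hypotheses (e_sym : symmetric e) (s_e : edge_list e s).

Lemma size_edge_list : size s = #|edges e|.
Proof. by rewrite cardE -(perm_size s_e) size_map. Qed.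

Lemma edge_listP q : q \in s -> e q.1 q.2.
Proof.
move=> qs; have : [set q.1; q.2] \in edges e.
  by rewrite -mem_enum -(perm_mem s_e); apply/mapP; exists q.
case/imsetP=> -[x y]; rewrite inE /= => exy /set2_inj[] [-> ->] //.
by rewrite e_sym.
Qed.

Lemma edge_list_set f : f \in edges e -> exists2 q, q \in s & f = [set q.1; q.2].
Proof. by rewrite -mem_enum -(perm_mem s_e) => /mapP[q]; exists q. Qed.

Lemma edge_list_mem x y : e x y -> (x, y) \in s \/ (y, x) \in s.
Proof.
move=> exy; have /edge_list_set[[z w] qs /set2_inj[]] : [set x; y] \in edges e.
- by apply/imsetP; exists (x, y); rewrite ?inE.
- by move=> ->; left.
- by move=> [-> ->]; right.
Qed.

End EdgeList.

(** * Reasoning about programs *)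

Fixpoint wregs (p : cmd) : seq nat :=
  match p with
  | Assign x _ => [:: x]
  | Seq p1 p2 | If _ p1 p2 => wregs p1 ++ wregs p2
  | While _ p1 => wregs p1
  | _ => [::]
  end.

Fixpoint warrs (p : cmd) : seq nat :=
  match p with
  | Put a _ _ => [:: a]
  | Seq p1 p2 | If _ p1 p2 => warrs p1 ++ warrs p2
  | While _ p1 => warrs p1
  | _ => [::]
  end.

Fixpoint positive (x : expr) : bool :=
  match x with
  | Const v => 0 < v
  | Add x1 x2 => positive x1 || positive x2
  | _ => false
  end.

Fixpoint puts_positive (p : cmd) : bool :=
  match p with
  | Put _ _ v => positive v
  | Seq p1 p2 | If _ p1 p2 => puts_positive p1 && puts_positive p2
  | While _ p1 => puts_positive p1
  | _ => true
  end.

Definition bounded (B : nat) (s : state) : Prop :=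
  (forall x, reg s x <= B) /\ (forall a i, arr s a i <= B).

(** What holds for every execution of [p] for syntactic reasons: the word bound
    is kept, registers and arrays that [p] does not assign are unchanged, and, if
    [p] only writes positive values, nonzero cells stay nonzero. *)
Record evolves (B : nat) (p : cmd) (s s' : state) : Prop := Evolves {
  evolves_bounded : bounded B s';
  evolves_reg : forall x, x \notin wregs p -> reg s' x = reg s x;
  evolves_arr : forall a i, a \notin warrs p -> arr s' a i = arr s a i;
  evolves_mono : forall a i, arr s a i != 0 -> arr s' a i != 0 }.

Lemma positiveP s x : positive x -> 0 < eval s x.
Proof. by elim: x => //= x1 IH1 x2 IH2 /orP[/IH1|/IH2]; lia. Qed.

Lemma fits_eval B s x : fits B s x -> eval s x <= B.
Proof. by case: x => /= [v|r|a i|x1 x2|x1 x2] /andP[]. Qed.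

Lemma evolves_trans B p s1 s2 s3 :
  evolves B p s1 s2 -> evolves B p s2 s3 -> evolves B p s1 s3.
Proof.
move=> [b1 r1 a1 m1] [b2 r2 a2 m2]; split=> // [x xp|a i ap|a i h].
- by rewrite r2 ?r1.
- by rewrite a2 ?a1.
- by apply/m2/m1.
Qed.

Lemma evolves_sub B p q s1 s2 :
  {subset wregs p <= wregs q} -> {subset warrs p <= warrs q} ->
  evolves B p s1 s2 -> evolves B q s1 s2.
Proof.
move=> sr sa [b r a m]; split=> // [x xq|b' i aq].
- by apply: r; apply: contra xq; apply: sr.
- by apply: a; apply: contra aq; apply: sa.
Qed.

Lemma exec_evolves B p s t s' :
  exec B p s t s' -> puts_positive p -> bounded B s -> evolves B p s s'.
Proof.
elim=> {p s t s'} //=.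
- move=> x v s fv _ [br ba]; split=> //=.
    by split=> //= y; case: eqP => // _; apply: fits_eval.
  by move=> y; rewrite inE => /negbTE->.
- move=> a i v s fi fv pv [br ba]; split=> //=.
  + by split=> //= b j; case: ifP => // _; apply: fits_eval.
  + by move=> b j; rewrite inE => /negbTE->.
  + by move=> b j h; case: ifP => // _; rewrite -lt0n positiveP.
- move=> p1 p2 s1 t1 s2 t2 s3 _ IH1 _ IH2 /andP[h1 h2] b1.
  have E1 := IH1 h1 b1; have E2 := IH2 h2 (evolves_bounded E1).
  apply: (@evolves_trans _ _ _ s2); [apply: evolves_sub E1 | apply: evolves_sub E2];
    by move=> x /=; rewrite mem_cat => ->; rewrite ?orbT.
- move=> b p1 p2 s t s' _ _ IH /andP[h1 h2] bs.
  by case: ifP IH => _ IH; apply: evolves_sub (IH _ bs) => // x /=;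
     rewrite mem_cat => ->; rewrite ?orbT.
- move=> b p s1 t1 s2 t2 s3 _ _ _ IH1 _ IH2 hp b1.
  have E1 := IH1 hp b1; apply: (@evolves_trans _ _ _ s2).
    exact: evolves_sub E1.
  exact: IH2 hp (evolves_bounded E1).
Qed.

Definition runs (B : nat) (p : cmd) (s : state) (T : nat) (Q : state -> Prop) : Prop :=
  exists t s', [/\ exec B p s t s', t <= T & Q s'].

Lemma runs_evolves B p s T (Q : state -> Prop) :
  puts_positive p -> bounded B s -> runs B p s T Q ->
  runs B p s T (fun s' => Q s' /\ evolves B p s s').
Proof.
move=> hp bs [t [s' [ex le_t q]]]; exists t, s'; split=> //; split=> //.
exact: exec_evolves ex hp bs.
Qed.

Lemma runs_weaken B p s T T' (Q Q' : state -> Prop) :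
  T <= T' -> (forall s', Q s' -> Q' s') -> runs B p s T Q -> runs B p s T' Q'.
Proof.
move=> le_T qq [t [s' [ex le_t q]]]; exists t, s'; split; auto; lia.
Qed.

Lemma runs_keep B p s T (Q Q' : state -> Prop) :
  puts_positive p -> bounded B s -> runs B p s T Q ->
  (forall s', Q s' -> evolves B p s s' -> Q' s') -> runs B p s T Q'.
Proof.
move=> hp bs r h; apply: runs_weaken (leqnn T) _ (runs_evolves hp bs r).
by move=> s' [q E]; apply: h.
Qed.

Lemma runs_seq B p1 p2 s T1 T2 (Q1 Q2 : state -> Prop) :
  runs B p1 s T1 Q1 -> (forall s', Q1 s' -> runs B p2 s' T2 Q2) ->
  runs B (Seq p1 p2) s (T1 + T2) Q2.
Proof.
move=> [t1 [s1 [ex1 le1 q1]]] h; have [t2 [s2 [ex2 le2 q2]]] := h _ q1.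
exists (t1 + t2), s2; split=> //; first exact: ExecSeq ex1 ex2.
by lia.
Qed.

(** Weakest preconditions of loop-free programs; loops are left to [runs_for]. *)
Fixpoint wp (B : nat) (p : cmd) (s : state) (Q : state -> Prop) : Prop :=
  match p with
  | Skip => Q s
  | Assign x v => fits B s v /\ Q (set_reg s x (eval s v))
  | Put a i v => [/\ fits B s i, fits B s v & Q (set_arr s a (eval s i) (eval s v))]
  | Seq p1 p2 => wp B p1 s (fun s' => wp B p2 s' Q)
  | If b p1 p2 =>
      fits_test B s b /\ if eval_test s b then wp B p1 s Q else wp B p2 s Q
  | While _ _ => False
  end.

(** For loop-free programs only. Adding up both branches of a conditional is a
    crude but sufficient bound. *)
Fixpoint maxtime (p : cmd) : nat :=
  match p with
  | Skip => 0
  | Assign _ v => (cost v).+1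
  | Put _ i v => (cost i + cost v).+1
  | Seq p1 p2 => maxtime p1 + maxtime p2
  | If b p1 p2 => cost_test b + (maxtime p1 + maxtime p2)
  | While _ _ => 0
  end.

Lemma wp_runs B p s Q : wp B p s Q -> runs B p s (maxtime p) Q.
Proof.
elim: p s Q => [|x v|a i v|p1 IH1 p2 IH2|b p1 IH1 p2 IH2|//] s Q /=.
- by exists 0, s; split=> //; constructor.
- by case=> fv q; exists (cost v).+1; eexists; split; [constructor|..|exact: q].
- by case=> fi fv q; exists (cost i + cost v).+1; eexists; split; [constructor|..|exact: q].
- by move=> /IH1 h; apply: runs_seq h _ => s' /IH2.
- case=> fb q.
  have [t [s' [ex le_t q']]] :
      runs B (if eval_test s b then p1 else p2) s (maxtime p1 + maxtime p2) Q.
    by case: ifP q => _ => [/IH1|/IH2]; apply: runs_weaken => //; lia.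
  by exists (cost_test b + t), s'; split=> //; [exact: ExecIf | lia].
Qed.

Definition for_loop (i N : nat) (body : cmd) : cmd :=
  Seq (Assign i (Const 0))
    (While (Lt (Reg i) (Reg N))
      (Seq body (Assign i (Add (Reg i) (Const 1))))).

(** The invariant [Inv j] speaks of the state in which the counter is already
    [j]. The hypothesis [evolves] in the step gives access to everything that the
    loop does not touch, so that [Inv] need not repeat it. In the running time,
    [7] is the cost of one test and one increment, and [5] that of the
    initialization and the last test. *)
Lemma runs_for B i r body s N T (Inv : nat -> state -> Prop) :
  bounded B s -> puts_positive body ->
  reg s r = N -> r != i -> i \notin wregs body -> r \notin wregs body ->
  Inv 0 (set_reg s i 0) ->
  (forall j st, j < N -> reg st i = j -> Inv j st ->
     evolves B (for_loop i r body) s st ->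
     runs B body st T (fun st' => Inv j.+1 (set_reg st' i j.+1))) ->
  runs B (for_loop i r body) s (N * (T + 7) + 5) (Inv N).
Proof.
move=> bs hp rN ri ib rb I0 step.
pose P := for_loop i r body.
have NB : N <= B by rewrite -rN; case: bs.
have E0 : evolves B P s (set_reg s i 0).
  apply: (@evolves_sub B (Assign i (Const 0))) => //.
    by move=> x /=; rewrite !inE => ->.
  by apply: exec_evolves bs => //; constructor.
rewrite (_ : N * (T + 7) + 5 = 2 + (N * (T + 7) + 3)); last by lia.
apply: (@runs_seq _ _ _ _ _ _ (eq (set_reg s i 0))).
  by apply: wp_runs => /=.
move=> _ <-.
(* Induction on the number [k] of iterations that remain. *)
have loop k st : k <= N -> reg st i = N - k -> Inv (N - k) st -> evolves B P s st ->
    runs B (While (Lt (Reg i) (Reg r)) (Seq body (Assign i (Add (Reg i) (Const 1)))))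
      st (k * (T + 7) + 3) (Inv N).
  elim: k st => [|k IHk] st le_k ri' I E.
    rewrite subn0 in ri' I.
    have rr : reg st r = N.
      by rewrite (evolves_reg E) //= inE mem_cat !inE (negbTE rb) (negbTE ri).
    exists 3, st; split=> //; apply: (ExecWhileFalse (b := Lt (Reg i) (Reg r))) => /=.
      by rewrite rr ri' NB.
    by rewrite rr ri' ltnn.
  have rr : reg st r = N.
    by rewrite (evolves_reg E) //= inE mem_cat !inE (negbTE rb) (negbTE ri).
  have lt_k : N - k.+1 < N by lia.
  have [t1 [s1 [ex1 le1 [I1 E1]]]] :=
    runs_evolves hp (evolves_bounded E) (step _ st lt_k ri' I E).
  have r1 : reg s1 i = N - k.+1 by rewrite (evolves_reg E1).
  have eN : (N - k.+1).+1 = N - k by lia.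
  have ex1' : exec B (Assign i (Add (Reg i) (Const 1))) s1 4 (set_reg s1 i (N - k)).
    have := @ExecAssign B i (Add (Reg i) (Const 1)) s1; rewrite /= r1 addn1 eN; apply.
    by apply/and3P; split; lia.
  have E2 : evolves B P s (set_reg s1 i (N - k)).
    apply: evolves_trans E _; apply: (@evolves_trans _ _ _ s1).
      apply: evolves_sub E1.
    - by move=> x /= xb; rewrite inE mem_cat xb orbT.
    - by move=> x /= xb; rewrite cats0.
    apply: evolves_sub (exec_evolves ex1' _ (evolves_bounded E1)) => //.
    by move=> x /=; rewrite !inE => ->.
  have [||||t2 [s2 [ex2 le2 I2]]] := IHk (set_reg s1 i (N - k)).
  - by lia.
  - by rewrite /= eqxx.
  - by rewrite -eN.
  - by [].
  exists (3 + (t1 + 4) + t2), s2; split=> //; last by rewrite mulSn; lia.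
  apply: (ExecWhileTrue (b := Lt (Reg i) (Reg r))) ex2; last exact: ExecSeq ex1 ex1'.
  - by rewrite /= rr ri' NB; lia.
  - by rewrite /= rr ri'.
by apply: loop; rewrite ?subnn //= eqxx.
Qed.

Lemma bounded_set_reg B st x v : bounded B st -> v <= B -> bounded B (set_reg st x v).
Proof. by move=> [bR bA] vB; split=> //= y; case: ifP. Qed.

Lemma bounded_set_arr B st a i v : bounded B st -> v <= B -> bounded B (set_arr st a i v).
Proof. by move=> [bR bA] vB; split=> //= b y; case: ifP. Qed.


(** * The program *)

(** Notations rather than definitions, so that comparisons of register and array
    numbers compute during symbolic execution.

    The tables [aDist], [aZero], [aOne] hold, for the current source, color and
    a vertex [v]: the distance of [v] plus one, whether some geodesic to [v]
    avoids the color, and whether some geodesic to [v] has it exactly once; zero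
    means unknown. As there is no multiplication, [rBase] and [rRow] hold the
    running values of [(u * m + j) * n] and [u * n]. *)
Notation rN := 0 (only parsing).
Notation rM := 1 (only parsing).
Notation rU := 3 (only parsing).
Notation rJ := 4 (only parsing).
Notation rD := 5 (only parsing).
Notation rG := 6 (only parsing).
Notation rBase := 7 (only parsing).
Notation rCol := 8 (only parsing).
Notation rRow := 9 (only parsing).
Notation rX := 10 (only parsing).
Notation rY := 11 (only parsing).
Notation rAns := 12 (only parsing).
Notation aAns := 3 (only parsing).
Notation aDist := 4 (only parsing).
Notation aZero := 5 (only parsing).
Notation aOne := 6 (only parsing).

Definition mark_one : cmd :=
  Seq (Put aAns (Reg rAns) (Const 1)) (Put aOne (Reg rY) (Const 1)).

Definition propagate : cmd :=
  If (Eq (Get 2 (Reg rG)) (Reg rCol))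
    (If (Eq (Get aZero (Reg rX)) (Const 0)) Skip mark_one)
    (Seq (If (Eq (Get aZero (Reg rX)) (Const 0)) Skip
            (Put aZero (Reg rY) (Const 1)))
         (If (Eq (Get aOne (Reg rX)) (Const 0)) Skip mark_one)).

(** Relaxation of edge [rG], from its end in array [a1] to its end in [a2]. *)
Definition relax (a1 a2 : nat) : cmd :=
  Seq (Assign rX (Add (Reg rBase) (Get a1 (Reg rG))))
  (Seq (Assign rY (Add (Reg rBase) (Get a2 (Reg rG))))
  (Seq (Assign rAns (Add (Reg rRow) (Get a2 (Reg rG))))
  (If (Eq (Get aDist (Reg rX)) (Add (Reg rD) (Const 1)))
    (Seq (If (Eq (Get aDist (Reg rY)) (Const 0))
            (Put aDist (Reg rY) (Add (Reg rD) (Const 2))) Skip)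
         (If (Eq (Get aDist (Reg rY)) (Add (Reg rD) (Const 2)))
            propagate Skip))
    Skip))).

Definition layer : cmd := for_loop rG rM (Seq (relax 0 1) (relax 1 0)).

Definition start_stage : cmd :=
  Seq (Assign rCol (Get 2 (Reg rJ)))
  (Seq (Put aDist (Add (Reg rBase) (Reg rU)) (Const 1))
       (Put aZero (Add (Reg rBase) (Reg rU)) (Const 1))).

(** Dynamic programming for source [rU] and the color of edge [rJ]. *)
Definition stage : cmd :=
  Seq start_stage
  (Seq (for_loop rD rN layer)
       (Assign rBase (Add (Reg rBase) (Reg rN)))).

Definition source : cmd :=
  Seq (for_loop rJ rM stage) (Assign rRow (Add (Reg rRow) (Reg rN))).

Definition algorithm : cmd := for_loop rU rN source.

(** * Running time *)

(** [7] and [5] come from [runs_for]; [4] is the cost of the last assignment of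
    [stage] and of [source]. *)
Definition time_layer (m : nat) := m * (maxtime (Seq (relax 0 1) (relax 1 0)) + 7) + 5.
Definition time_stage (n m : nat) := maxtime start_stage + (n * (time_layer m + 7) + 5 + 4).
Definition time_source (n m : nat) := m * (time_stage n m + 7) + 5 + 4.
Definition time_algorithm (n m : nat) := n * (time_source n m + 7) + 5.

(** [time_algorithm] is a polynomial in [n] and [m], each of whose monomials is at
    most [n ^ 2 * m ^ 2]; its value at [1], [1] is the sum of its coefficients. If
    there is no edge, then [n = 1] and the time is constant. *)
Lemma time_algorithm_le n m : 0 < n -> (n <= 1) || (0 < m) ->
  time_algorithm n m <= time_algorithm 1 1 * (n ^ 2 * m ^ 2).+1.
Proof.
rewrite /time_algorithm /time_source /time_stage /time_layer.
move: (maxtime _) (maxtime start_stage) => r i n0 nm.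
have [m0 | m0] := posnP m.
  have -> : n = 1 by move: nm; rewrite m0; lia.
  by rewrite m0; lia.
rewrite -expnMn -mulnn; set p := n * m.
have p0 : 0 < p by rewrite muln_gt0 n0.
have np : n <= p by apply: leq_pmulr.
have pX : p <= p * p by apply: leq_pmulr.
have npX : n * p <= p * p by rewrite leq_mul2r np orbT.
have iX : i * p <= i * (p * p) by rewrite leq_mul2l pX orbT.
have -> : n * (m * (i + (n * (m * (r + 7) + 5 + 7) + 5 + 4) + 7) + 5 + 4 + 7) + 5 =
  p * p * (r + 7) + 12 * (n * p) + i * p + 16 * p + 16 * n + 5 by rewrite /p; lia.
lia.
Qed.

(** * Correctness *)

Section Correctness.
Variables (n : nat) (e : rel 'I_n) (c : {set 'I_n} -> nat).
Variables (s : seq ('I_n * 'I_n)) (q0 : 'I_n * 'I_n) (B : nat).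
Hypotheses (e_sym : symmetric e) (e_con : forall u v, connect e u v).
Hypothesis s_e : edge_list e s.
Hypotheses (base_le : n * size s * n <= B) (row_le : n * n <= B) (n_lt : n < B).

Local Notation m := (size s).
Implicit Types (u v x y : 'I_n) (A : nat -> nat -> nat) (st : state).

Definition listed g := nth q0 s g.
Definition col g := c [set (listed g).1; (listed g).2].

(** Numbers in mixed radix: the blocks of different pairs [(u, j)] are
    disjoint. *)
Definition addr u j v := (u * m + j) * n + v.

(** Every nonzero cell tells the truth. The last implication of the first part
    records that an answer is given as soon as [aOne] reveals it. *)
Definition sound A : Prop :=
  (forall u j v, j < m ->
    [/\ A aDist (addr u j v) != 0 -> A aDist (addr u j v) = (gdist e u v).+1,
        A aZero (addr u j v) != 0 -> geo e c (col j) 0 u v,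
        A aOne (addr u j v) != 0 -> geo e c (col j) 1 u v
      & A aOne (addr u j v) != 0 -> A aAns (u * n + v) != 0]) /\
  (forall u v, A aAns (u * n + v) != 0 ->
     A aAns (u * n + v) = 1 /\ exists a, geo e c a 1 u v).

Definition settled u j v A : Prop :=
  [/\ A aDist (addr u j v) != 0,
      geo e c (col j) 0 u v -> A aZero (addr u j v) != 0
    & geo e c (col j) 1 u v -> A aOne (addr u j v) != 0].

Definition complete u j d A : Prop := forall v, gdist e u v <= d -> settled u j v A.

(** The premises are about [geo] rather than about the cells of [x], so that the
    property is preserved whenever more cells become nonzero. *)
Definition relaxed u j d x y A : Prop :=
  gdist e u x = d -> gdist e u y = d.+1 ->
  [/\ A aDist (addr u j y) != 0,
      geo e c (col j) 0 u x -> c [set x; y] != col j -> A aZero (addr u j y) != 0,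
      geo e c (col j) 0 u x -> c [set x; y] = col j -> A aOne (addr u j y) != 0
    & geo e c (col j) 1 u x -> c [set x; y] != col j -> A aOne (addr u j y) != 0].

Definition input_kept st : Prop :=
  [/\ reg st rN = n, reg st rM = m
    & forall g, g < m -> [/\ arr st 0 g = (listed g).1, arr st 1 g = (listed g).2
                           & arr st 2 g = col g]].

Lemma input_kept_evolves p st st' :
  evolves B p st st' -> input_kept st ->
  all (fun r => r \notin wregs p) [:: rN; rM] ->
  all (fun a => a \notin warrs p) [:: 0; 1; 2] -> input_kept st'.
Proof.
move=> [_ r a _] [S0 S1 S2] /and3P[h0 h1 _] /and4P[a0 a1 a2 _].
split; rewrite ?r // => g /S2[? ? ?].
by split; rewrite a.
Qed.

Lemma complete_mono u j d A A' :
  (forall a i, A a i != 0 -> A' a i != 0) -> complete u j d A -> complete u j d A'.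
Proof. by move=> h D v /D[? h0 h1]; split=> [|/h0|/h1]; auto. Qed.

Lemma relaxed_mono u j d x y A A' :
  (forall a i, A a i != 0 -> A' a i != 0) -> relaxed u j d x y A -> relaxed u j d x y A'.
Proof. by move=> h R dx dy; have [? h0 h1 h2] := R dx dy; split; auto. Qed.

Lemma divmod_inj k a b a' b' :
  b < k -> b' < k -> a * k + b = a' * k + b' -> a = a' /\ b = b'.
Proof.
move=> bk b'k E; have k0 : 0 < k by lia.
have := congr1 (divn^~ k) E; have := congr1 (modn^~ k) E.
by rewrite /= !modnMDl !modn_small // !divnMDl // !divn_small // !addn0.
Qed.

Lemma row_inj u v u' v' : u * n + v = u' * n + v' -> (u, v) = (u', v').
Proof. by case/divmod_inj=> // /val_inj-> /val_inj->. Qed.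

Lemma addr_inj u j v u' j' v' :
  j < m -> j' < m -> addr u j v = addr u' j' v' -> (u, j, v) = (u', j', v').
Proof.
by move=> jm jm' /divmod_inj[] // /divmod_inj[] // /val_inj-> -> /val_inj->.
Qed.

Lemma next_base_le u j : j < m -> (u * m + j) * n + n <= B.
Proof.
move=> jm; apply: leq_trans base_le; rewrite -mulSnr leq_mul2r; apply/orP; right.
have := ltn_ord u; nia.
Qed.

Lemma addr_le u j v : j < m -> addr u j v <= B.
Proof. by move=> /(next_base_le u); rewrite /addr; have := ltn_ord v; lia. Qed.

Lemma next_row_le u : u * n + n <= B.
Proof. by apply: leq_trans row_le; rewrite -mulSnr leq_mul2r ltn_ord orbT. Qed.

Lemma ans_le u v : u * n + v <= B.
Proof. by have := next_row_le u; have := ltn_ord v; lia. Qed.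

Lemma sound_dist u j y st z : j < m -> sound (arr st) -> z = (gdist e u y).+1 ->
  sound (arr (set_arr st aDist (addr u j y) z)).
Proof.
move=> jm [S1 S2] ->; split=> //= u' j' v jm'; have [h1 h2 h3 h4] := S1 u' j' v jm'; split=> //.
by case: (_ =P addr u j y) => // /(addr_inj jm' jm)[] -> _ ->.
Qed.

Lemma sound_zero u j y st : j < m -> sound (arr st) -> geo e c (col j) 0 u y ->
  sound (arr (set_arr st aZero (addr u j y) 1)).
Proof.
move=> jm [S1 S2] gy; split=> //= u' j' v jm'; have [h1 h2 h3 h4] := S1 u' j' v jm'; split=> //.
by case: (_ =P addr u j y) => // /(addr_inj jm' jm)[] -> -> ->.
Qed.

Lemma sound_one u j y st : j < m -> sound (arr st) -> geo e c (col j) 1 u y ->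
  sound (arr (set_arr (set_arr st aAns (u * n + y) 1) aOne (addr u j y) 1)).
Proof.
move=> jm [S1 S2] gy; split=> /= [u' j' v jm'|u' v].
  have [h1 h2 h3 h4] := S1 u' j' v jm'; split=> //.
    by case: (_ =P addr u j y) => // /(addr_inj jm' jm)[] -> -> ->.
  case: (_ =P addr u j y) => [/(addr_inj jm' jm)[] -> _ ->|_ /h4]; first by rewrite eqxx.
  by case: (_ =P u * n + y).
case: (_ =P u * n + y) => [/row_inj[-> ->] _|_]; last exact: S2.
by split=> //; exists (col j).
Qed.

(** The cells of [x] are exact, being those of a complete layer: nonzero ones are
    true by [sound], which justifies what is written for [y], and zero ones are
    false by [complete], so that nothing is missed. *)
Lemma wp_propagate u j d g x y st :
  j < m -> bounded B st -> e x y -> gdist e u x = d -> gdist e u y = d.+1 ->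
  reg st rG = g -> reg st rCol = col j ->
  reg st rX = addr u j x -> reg st rY = addr u j y -> reg st rAns = u * n + y ->
  arr st 2 g = c [set x; y] -> arr st aDist (addr u j y) != 0 ->
  sound (arr st) -> complete u j d (arr st) ->
  wp B propagate st (fun st' => sound (arr st') /\ relaxed u j d x y (arr st')).
Proof.
move=> jm [bR bA] exy dx dy rg rc rx ry ra ac Dy S D.
have [S1 S2] := S; have [_ X0 X1 _] := S1 u j x jm.
have [|_ D0 D1] := D x; first by rewrite dx.
have dxy : gdist e u y = (gdist e u x).+1 by rewrite dx.
have B0 : 0 < B by lia.
rewrite /= !bR !bA rg rc rx ry ra ac B0 /=.
split=> //; case: (eqVneq (c _) _) => [cj|cj].
  split=> //; case: (eqVneq (arr st aZero _) 0) => [z0|z0].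
    split=> // _ _; rewrite cj eqxx; by split=> // /D0; rewrite z0.
  split=> //; split=> //; split.
    apply: sound_one => //; have := geo_step (X0 z0) exy dxy; by rewrite cj eqxx.
  by move=> _ _; rewrite cj /= !eqxx.
split=> //; case: (eqVneq (arr st aZero _) 0) => [z0|z0].
  split=> //; case: (eqVneq (arr st aOne _) 0) => [o0|o0].
    split=> // _ _; split=> //; first by move=> /D0; rewrite z0.
      by move=> /D0; rewrite z0.
    by move=> /D1; rewrite o0.
  split=> //; split=> //; split.
    apply: sound_one => //; have := geo_step (X1 o0) exy dxy.
    by rewrite (negbTE cj) addn0.
  move=> _ _ /=; rewrite !eqxx; split=> //.
  by move=> /D0; rewrite z0.
have Y0 : geo e c (col j) 0 u y.
  by have := geo_step (X0 z0) exy dxy; rewrite (negbTE cj).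
split=> //; split=> //; case: (eqVneq (arr st aOne _) 0) => [o0|o0].
  split; first exact: sound_zero.
  move=> _ _ /=; rewrite !eqxx; split=> //; first by move=> _ E; rewrite E eqxx in cj.
  by move=> /D1; rewrite o0.
split=> //; split=> //; split.
  apply: (@sound_one _ _ _ (set_arr st aZero _ _)) => //; first exact: sound_zero.
  by have := geo_step (X1 o0) exy dxy; rewrite (negbTE cj) addn0.
by move=> _ _ /=; rewrite !eqxx.
Qed.

(** The test on [aDist] succeeds exactly if [x] is in layer [d]; then [y] is in
    layer [d.+1] at most, and not in a complete layer if its cell is zero. *)
Lemma wp_relax u j d g x y a1 a2 st :
  j < m -> d < n -> bounded B st -> e x y ->
  reg st rD = d -> reg st rG = g -> reg st rBase = (u * m + j) * n ->
  reg st rCol = col j -> reg st rRow = u * n ->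
  arr st a1 g = x -> arr st a2 g = y -> arr st 2 g = c [set x; y] ->
  sound (arr st) -> complete u j d (arr st) ->
  wp B (relax a1 a2) st (fun st' => sound (arr st') /\ relaxed u j d x y (arr st')).
Proof.
move=> jm dn bB exy rd rg rb rc rr ax ay ac S D.
have [bR bA] := bB; have [S1 S2] := S.
have [X _ _ _] := S1 u j x jm; have [Y _ _ _] := S1 u j y jm.
(* [propagate] is abstracted to keep symbolic execution from entering it. *)
have HP st' := @wp_propagate u j d g x y st'.
rewrite /relax; move: propagate HP => P HP /=.
rewrite !bR !bA rg rb rr rd ax ay -/(addr u j x) -/(addr u j y) /= eqxx !addr_le // ans_le /=.
do 3!split=> //.
split; first by apply/and3P; split; lia.
case: (eqVneq (arr st aDist _) (d + 1)) => [Dx|Dx]; last first.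
  split=> // dx; case/eqP: Dx; rewrite X ?dx ?addn1 //.
  by have [|] := D x; rewrite ?dx.
have dx : gdist e u x = d by move: X; rewrite Dx addn1 => /(_ isT) [].
have le_dy : gdist e u y <= d.+1 by rewrite -dx gdist_step.
have bB' : bounded B
    (set_reg (set_reg (set_reg st rX (addr u j x)) rY (addr u j y)) rAns (u * n + y)).
  by do 3![apply: bounded_set_reg; last by rewrite ?addr_le ?ans_le].
split=> //; case: (eqVneq (arr st aDist _) 0) => [Dy|Dy].
  have dy : gdist e u y = d.+1.
    apply/eqP; rewrite eqn_leq le_dy ltnNge; apply/negP=> /D[].
    by rewrite Dy.
  split=> //; first by apply/and3P; split; lia.
  rewrite !eqxx; split; first by apply/and4P; split; lia.
  apply: HP => //=; rewrite ?eqxx ?addn2 //.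
  - by apply: bounded_set_arr bB' _; lia.
  - by apply: (@sound_dist _ _ _ st); rewrite ?dy.
  - apply: complete_mono D => a i h; by case: ifP.
split; first by apply/and3P; split; lia.
case: (eqVneq (arr st aDist _) (d + 2)) => [Dy'|Dy'].
  have dy : gdist e u y = d.+1 by have := Y Dy; rewrite Dy' addn2 => -[].
  exact: HP.
by split=> // _ dy; case/eqP: Dy'; rewrite (Y Dy) dy addn2.
Qed.

(** A vertex of layer [d.+1] is settled by the edges through which geodesics
    reach it ([geo_pred]), all of which have been relaxed. *)
Lemma runs_layer u j d st :
  j < m -> d < n -> bounded B st -> input_kept st -> reg st rD = d ->
  reg st rBase = (u * m + j) * n -> reg st rCol = col j -> reg st rRow = u * n ->
  sound (arr st) -> complete u j d (arr st) ->
  runs B layer st (m * (maxtime (Seq (relax 0 1) (relax 1 0)) + 7) + 5)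
    (fun st' => sound (arr st') /\ complete u j d.+1 (arr st')).
Proof.
move=> jm dn bB Sst rd rb rc rr S D.
pose Inv i st' := sound (arr st') /\ forall g, g < i ->
  relaxed u j d (listed g).1 (listed g).2 (arr st') /\
  relaxed u j d (listed g).2 (listed g).1 (arr st').
apply: (@runs_weaken _ _ _ (m * (maxtime (Seq (relax 0 1) (relax 1 0)) + 7) + 5) _
  (fun st' => Inv m st' /\ evolves B layer st st')) => //.
  move=> st' [[S' R] E]; split=> // v; rewrite leq_eqVlt ltnS => /orP[/eqP dv|]; last first.
    exact: (complete_mono (evolves_mono E) D).
  have R' x y : e x y -> relaxed u j d x y (arr st').
    move=> /(edge_list_mem s_e)[] /(nthP q0)[g gm E'];
      have [] := R g gm; by rewrite /listed E'.
  have [x exv dx] := gdist_pred (e_con u v) dv.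
  have [v0 _ _ _] := R' _ _ exv dx dv.
  split=> // /geo_pred /(_ dv) [x' [i [ex' dx' gx']]].
    have [_ h0 _ _] := R' _ _ ex' dx' dv.
    by case: eqP => // /eqP nc; case: i gx' => // gx' _; apply: h0.
  have [_ _ h0 h1] := R' _ _ ex' dx' dv.
  case: eqP => [ec|/eqP nc]; case: i gx' => [|[|i]] gx' //= _; [exact: h0|exact: h1].
apply: runs_evolves => //; apply: runs_for => //; first by case: Sst.
move=> g st1 gm rg [S1 R1] E1.
have b1 := evolves_bounded E1.
have [_ _ inp] := input_kept_evolves E1 Sst isT isT.
have [i0 i1 i2] := inp g gm.
have eg : e (listed g).1 (listed g).2 by apply: (edge_listP e_sym s_e); apply: mem_nth.
have D1 := complete_mono (evolves_mono E1) D.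
apply: (@runs_keep _ _ _ _ (fun st' => sound (arr st') /\
    (relaxed u j d (listed g).1 (listed g).2 (arr st') /\
     relaxed u j d (listed g).2 (listed g).1 (arr st')))) => //; last first.
  move=> st2 [S2 R2] E2; split=> //= g'; rewrite ltnS leq_eqVlt => /orP[/eqP->//|/R1[r1 r2]].
  by split; apply: relaxed_mono (evolves_mono E2) _.
have W1 := @wp_relax u j d g (listed g).1 (listed g).2 0 1 st1 jm dn b1 eg.
apply: (@runs_seq _ _ _ _ _ _ (fun st' =>
    (sound (arr st') /\ relaxed u j d (listed g).1 (listed g).2 (arr st')) /\
    evolves B (relax 0 1) st1 st')).
  apply: runs_evolves => //; apply: wp_runs; apply: W1 => //; by rewrite (evolves_reg E1).
move=> st2 [[S2 R2] E2].
have b2 := evolves_bounded E2.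
apply: (@runs_keep _ _ _ _ (fun st' => sound (arr st') /\
    relaxed u j d (listed g).2 (listed g).1 (arr st'))) => //; last first.
  move=> st3 [S3 R3] E3; split=> //; split=> //.
  by apply: relaxed_mono (evolves_mono E3) R2.
have rg2 : reg st2 rG = g by rewrite (evolves_reg E2).
apply: wp_runs; apply: (@wp_relax u j d g) => //;
  rewrite ?(evolves_reg E2) ?(evolves_reg E1) ?(evolves_arr E2) //.
- by rewrite e_sym.
- by rewrite i2 /col setUC.
- exact: complete_mono (evolves_mono E2) D1.
Qed.

Lemma runs_stage u j st :
  j < m -> bounded B st -> input_kept st -> reg st rU = u -> reg st rJ = j ->
  reg st rBase = (u * m + j) * n -> reg st rRow = u * n -> sound (arr st) ->
  runs B stage st (time_stage n m)
    (fun st' => [/\ sound (arr st'), complete u j n (arr st')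
                  & reg st' rBase = (u * m + j) * n + n]).
Proof.
move=> jm bB Sst ru rj rb rr S; have [bR bA] := bB; have [sn sm inp] := Sst.
have [_ _ cj] := inp j jm.
apply: (@runs_seq _ _ _ _ _ _ (fun st' =>
   [/\ sound (arr st'), complete u j 0 (arr st') & reg st' rCol = col j] /\
   evolves B start_stage st st')).
  apply: runs_evolves => //; apply: wp_runs => /=.
  rewrite !bR !bA rj rb ru cj -/(addr u j u) addr_le //= (leq_ltn_trans _ n_lt) //=.
  split=> //; split=> //; split=> //; split=> //.
    apply: (@sound_zero _ _ _ (set_arr st _ _ _)) => //; last exact: geo_refl.
    by apply: (@sound_dist _ _ _ st) => //; rewrite gdist_refl.
  move=> v; rewrite leqn0 => /eqP /(gdist_eq0 (e_con u v)) ->; split; rewrite /= ?eqxx //.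
  by case=> p [_ _]; rewrite gdist_refl => /size0nil->.
move=> st1 [[S1 D1 rc1] E1].
have b1 := evolves_bounded E1; have S1st := input_kept_evolves E1 Sst isT isT.
apply: (@runs_seq _ _ _ _ _ _ (fun st' =>
    (sound (arr st') /\ complete u j n (arr st')) /\
    evolves B (for_loop rD rN layer) st1 st')).
  apply: runs_evolves => //.
  apply: (@runs_for _ _ _ _ _ _ _ (fun d st' =>
      sound (arr st') /\ complete u j d (arr st'))) => //.
    by case: S1st.
  move=> d st2 dn rd [S2 D2] E2.
  have rc2 : reg st2 rCol = col j by rewrite (evolves_reg E2).
  apply: runs_layer => //; rewrite ?(evolves_reg E2) ?(evolves_reg E1) //.
    exact: evolves_bounded E2.
  exact: input_kept_evolves E2 S1st isT isT.
move=> st2 [[S2 D2] E2]; have b2 := evolves_bounded E2; have [bR2 bA2] := b2.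
apply: wp_runs => /=; rewrite !bR2 (evolves_reg E2) // (evolves_reg E1) // rb.
rewrite (evolves_reg E2) // (evolves_reg E1) // sn.
by rewrite next_base_le.
Qed.

Lemma runs_source u st :
  bounded B st -> input_kept st -> reg st rU = u ->
  reg st rBase = u * m * n -> reg st rRow = u * n -> sound (arr st) ->
  runs B source st (time_source n m)
    (fun st' => [/\ sound (arr st'), forall j, j < m -> complete u j n (arr st'),
                  reg st' rBase = u.+1 * m * n & reg st' rRow = u.+1 * n]).
Proof.
move=> bB Sst ru rb rr S; have [sn sm _] := Sst.
apply: (@runs_seq _ _ _ _ _ _ (fun st' =>
    [/\ sound (arr st'), forall j, j < m -> complete u j n (arr st')
      & reg st' rBase = (u * m + m) * n] /\
    evolves B (for_loop rJ rM stage) st st')).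
  apply: runs_evolves => //.
  apply: (@runs_for _ _ _ _ _ _ _ (fun k st' =>
      [/\ sound (arr st'), forall j, j < k -> complete u j n (arr st')
        & reg st' rBase = (u * m + k) * n])) => //.
    by split=> //=; rewrite addn0.
  move=> j st1 jm rj [S1 D1 rb1] E1; have b1 := evolves_bounded E1.
  have S1st := input_kept_evolves E1 Sst isT isT.
  have ru1 : reg st1 rU = u by rewrite (evolves_reg E1).
  have rr1 : reg st1 rRow = u * n by rewrite (evolves_reg E1).
  apply: runs_keep (runs_stage jm b1 S1st ru1 rj rb1 rr1 S1) _ => //.
  move=> st2 [S2 D2 rb2] E2; split=> //=; last by rewrite rb2 addnS mulSnr.
  move=> j'; rewrite ltnS leq_eqVlt => /orP[/eqP->//|/D1]; exact: complete_mono (evolves_mono E2).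
move=> st1 [[S1 D1 rb1] E1]; have [bR1 _] := evolves_bounded E1.
apply: wp_runs => /=; rewrite !bR1 (evolves_reg E1) // rr (evolves_reg E1) // sn next_row_le.
by split=> //; split=> //; rewrite ?rb1 // !mulSnr // mulnDl.
Qed.

Lemma runs_algorithm st :
  bounded B st -> input_kept st -> reg st rBase = 0 -> reg st rRow = 0 ->
  sound (arr st) ->
  runs B algorithm st (time_algorithm n m)
    (fun st' => sound (arr st') /\ forall u j, j < m -> complete u j n (arr st')).
Proof.
move=> bB Sst rb rr S; have [sn sm _] := Sst.
pose Inv k st' := [/\ sound (arr st'), forall u j, u < k -> j < m -> complete u j n (arr st'),
  reg st' rBase = k * m * n & reg st' rRow = k * n].
apply: (@runs_weaken _ _ _ (time_algorithm n m) _ (Inv n)) => //.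
  by move=> st' [S' D' _ _]; split=> // u j jm; apply: D'.
apply: runs_for => // k st1 kn ru [S1 D1 rb1 rr1] E1.
have b1 := evolves_bounded E1; have S1st := input_kept_evolves E1 Sst isT isT.
pose u := Ordinal kn.
apply: runs_keep (runs_source (u := u) b1 S1st ru rb1 rr1 S1) _ => //.
move=> st2 [S2 D2 rb2 rr2] E2; split=> //= u' j; rewrite ltnS leq_eqVlt => /orP[/eqP eu|u'k] jm.
  by rewrite (_ : u' = u); [apply: D2 | apply: val_inj].
by apply: complete_mono (evolves_mono E2) _; apply: D1.
Qed.

(** Distances are at most [n], so that [n] layers cover all the vertices. *)
Lemma answersP A st' : arr st' = A -> sound A -> (forall u j, j < m -> complete u j n A) ->
  answers st' (conflict_free_geodesic e c).
Proof.
move=> <- [S1 S2] D u v _; split=> [/cfgP[a gu]|ncf]; last first.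
  by apply/eqP/negP=> /negP /S2[_ cf]; apply/ncf/cfgP.
have [f /(edge_list_set s_e)[q /(nthP q0)[j jm qj] ->] cf] := geo_color gu.
have aj : col j = a by rewrite /col /listed qj.
have dv : gdist e u v <= n by rewrite -[X in _ <= X]card_ord gdist_leV.
have [_ _ h1] := D u j jm v dv.
have [_ _ _ h2] := S1 u j v jm.
by have [] := S2 u v (h2 (h1 _)); rewrite ?aj.
Qed.

End Correctness.

(** * The theorem *)

Theorem theorem2p7 :
  exists (p : cmd) (C D : nat),
  forall (n k : nat) (e : rel 'I_n) (c : {set 'I_n} -> nat)
    (s : seq ('I_n * 'I_n)),
    0 < n -> 0 < k ->
    symmetric e -> irreflexive e -> (forall u v : 'I_n, connect e u v) ->
    (forall f : {set 'I_n}, f \in edges e -> 1 <= c f <= k) ->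
    edge_list e s ->
    exists (t : nat) (s' : state),
      [/\ exec ((n + k) ^ D) p (input k c s) t s',
          t <= C * (n ^ 2 * #|edges e| ^ 2).+1
        & answers s' (conflict_free_geodesic e c)].
Proof.
exists algorithm, (time_algorithm 1 1), 4 => n k e c s n0 k0 e_sym _ e_con ck s_e.
(* Addresses are at most [n * m * n] or [n * n], where [m <= n * n]; all other
   numbers are at most [n + k]. *)
set B := (n + k) ^ 4.
have size_m : size s <= n * n.
  by have := card_edges_le e; rewrite card_ord (size_edge_list s_e).
have nkB : n + k < B.
  by rewrite /B -{1}(expn1 (n + k)) ltn_exp2l //; lia.
have nB : n < B by lia.
have n4B : n ^ 4 <= B by rewrite leq_exp2r // leq_addr.
have n4 : n * size s * n <= B.
  by apply: leq_trans n4B; rewrite !expnS expn0; nia.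
have n2 : n * n <= B.
  by apply: leq_trans n4B; rewrite !expnS expn0; nia.
pose q0 : 'I_n * 'I_n := (Ordinal n0, Ordinal n0).
have bB : bounded B (input k c s).
  split=> [[|[|[|x]]]|[|[|[|a]]] i] /=; rewrite ?nth_nil //; try lia.
  - have [lt_i|le_i] := ltnP i (size s); last by rewrite nth_default ?size_map.
    by rewrite (nth_map q0) //; have := ltn_ord (nth q0 s i).1; lia.
  - have [lt_i|le_i] := ltnP i (size s); last by rewrite nth_default ?size_map.
    by rewrite (nth_map q0) //; have := ltn_ord (nth q0 s i).2; lia.
  - have [lt_i|le_i] := ltnP i (size s); last by rewrite nth_default ?size_map.
    rewrite (nth_map q0) //; set f := [set _; _].
    have /ck : f \in edges e; last by lia.
    apply/imsetP; exists (nth q0 s i) => //.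
    by rewrite inE (edge_listP e_sym s_e) // mem_nth.
have inp : input_kept c s q0 (input k c s).
  by split=> // g gm; rewrite /= !(nth_map q0).
have S0 : sound e c s q0 (arr (input k c s)).
  by split=> [u j v _|u v]; rewrite /= ?nth_nil.
have [t [s' [ex le_t [S D]]]] := runs_algorithm e_sym e_con s_e n4 n2 nB bB inp erefl erefl S0.
exists t, s'; split=> //; last exact: answersP S D.
apply: leq_trans le_t _; rewrite -(size_edge_list s_e); apply: time_algorithm_le => //.
rewrite leqNgt (size_edge_list s_e) -{1}(card_ord n); apply/orP.
by case: (ltnP 1 #|'I_n|) => [/(edges_gt0 e_con)->|]; [right | left].
Qed.
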